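(* Let $n,m\ge 2$ be integers and let $S_{n,m}=|\mathrm{Sh}(a(n,m))|$ be the size of the shadow of the alcove $(n,m)$. Then $$S_{n,m}=\begin{cases}\dfrac{12nm+3n^2+3m^2-6n-6m}{4}& \text{if $n$ is even and $m$ is even,}\\[2mm] \dfrac{12nm+3n^2+3m^2-6n-12m+9}{4}& \text{if $n$ is even and $m$ is odd,}\\[2mm] \dfrac{12nm+3n^2+3m^2-6m-11}{4}& \text{if $n$ is odd and $m$ is even,}\\[2mm] \dfrac{12nm+3n^2+3m^2-12m-6}{4}& \text{if $n$ is odd and $m$ is odd.}\end{cases}$$
   Context: $W=\langle s_0,s_1,s_2\mid s_i^2=1,(s_0s_1)^3=(s_0s_2)^3=(s_1s_2)^3=1\rangle$ is the Coxeter group of type $\tilde A_2$. Subscripts of generators are read modulo 3. For $k\ge 0$, $\gamma_i(k)=s_is_{i+1}s_{i+2}\cdots$ ($k$ letters, subscripts increasing by one mod 3) and $\delta_i(k)=s_is_{i-1}s_{i-2}\cdots$ ($k$ letters, subscripts decreasing by one mod 3). Coordinates: elements of $W$ correspond bijectively to alcoves. For integers $n,m\ge 0$, the alcove $(n,m)$ is the element $a(n,m)=\gamma_0(n)\,\delta_{n+1}(m)\in W$ (both parities of $n$ are allowed: for $n$ even these are the paper's even coordinates, for $n$ odd its odd coordinates). Shadow: for $w\in W$ with reduced word $s_{i_1}\cdots s_{i_r}$, $\mathrm{Sh}(w)$ is the set of end alcoves $c_r$ of all (possibly folded) galleries $c_0=1,c_1,\dots,c_r$ with $c_t\in\{c_{t-1},c_{t-1}s_{i_t}\}$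 for each $t$. It does not depend on the reduced word and equals the Bruhat interval $[1,w]$. *)

(* Defs.v *)
From HB Require Import structures.
From mathcomp Require Import all_boot all_order all_algebra.
From mathcomp Require Import finmap.
From mathcomp Require Import boolp classical_sets cardinality.

Set Implicit Arguments.
Unset Strict Implicit.
Unset Printing Implicit Defensive.

Import GRing.Theory.
Local Open Scope quotient_scope.

(* The group W = < s_0, s_1, s_2 | relators > is the quotient of the free
   monoid of words in the generators by the congruence that the relators
   generate. Formal inverses of the letters are not needed: the relators
   s_i s_i make every letter its own inverse. *)

Definition word := seq 'Z_3.

Definition relators : seq word :=
  [:: [:: 0; 0]; [:: 1; 1]; [:: 2; 2];
      flatten (nseq 3 [:: 0; 1]);
      flatten (nseq 3 [:: 0; 2]);
      flatten (nseq 3 [:: 1; 2])]%R.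

Inductive wcong : word -> word -> Prop :=
| wcong_rel r of r \in relators : wcong r [::]
| wcong_refl u : wcong u u
| wcong_sym u v of wcong u v : wcong v u
| wcong_trans v u w of wcong u v & wcong v w : wcong u w
| wcong_cat u u' v v' of wcong u u' & wcong v v' : wcong (u ++ v) (u' ++ v').

Definition wcongb (u v : word) : bool := `[< wcong u v >].

Lemma wcongb_refl : reflexive wcongb.
Proof. by move=> u; apply/asboolP/wcong_refl. Qed.

Lemma wcongb_sym : symmetric wcongb.
Proof. by move=> u v; apply/asboolP/asboolP; apply: wcong_sym. Qed.

Lemma wcongb_trans : transitive wcongb.
Proof.
by move=> v u w /asboolP uv /asboolP vw; apply/asboolP/(wcong_trans uv vw).
Qed.

Canonical wcong_equiv := EquivRel wcongb wcongb_refl wcongb_sym wcongb_trans.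

Definition W := {eq_quot wcong_equiv}.

HB.instance Definition _ := Choice.on W.

Definition elt (u : word) : W := \pi_W u.

Lemma eltP u v : elt u = elt v <-> wcong u v.
Proof.
split=> [/eqmodP/asboolP // | uv].
by apply/eqmodP/asboolP.
Qed.

Lemma elt_repr (x : W) : elt (repr x) = x.
Proof. exact: reprK. Qed.

Definition Wmul (x y : W) : W := elt (repr x ++ repr y).
Definition Winv (x : W) : W := elt (rev (repr x)).

Lemma Wmul_elt u v : Wmul (elt u) (elt v) = elt (u ++ v).
Proof. by apply/eltP/wcong_cat; apply/eltP; rewrite elt_repr. Qed.

Lemma wcong_sq (i : 'Z_3) : wcong [:: i; i] [::].
Proof. by apply: wcong_rel; case: i => [[|[|[|//]]] lti]. Qed.

Lemma wcong_revl u : wcong (rev u ++ u) [::].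
Proof.
elim: u => [|i u IHu]; first exact: wcong_refl.
rewrite rev_cons cat_rcons -(cat1s i (i :: u)) -(cat1s i u).
apply: wcong_trans IHu; apply: wcong_cat; first exact: wcong_refl.
rewrite catA -[X in wcong _ X]cat0s.
by apply: wcong_cat; [exact: wcong_sq | exact: wcong_refl].
Qed.

Fact WmulA : associative Wmul.
Proof.
move=> x y z; rewrite -(elt_repr x) -(elt_repr y) -(elt_repr z).
by rewrite !Wmul_elt catA.
Qed.

Fact Wmul1w : left_id (elt [::]) Wmul.
Proof. by move=> x; rewrite -(elt_repr x) Wmul_elt. Qed.

Fact Wmulw1 : right_id (elt [::]) Wmul.
Proof. by move=> x; rewrite -(elt_repr x) Wmul_elt cats0. Qed.

Fact WmulVw : left_inverse (elt [::]) Winv Wmul.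
Proof.
move=> x; rewrite -[X in Wmul _ X]elt_repr Wmul_elt.
exact/eltP/wcong_revl.
Qed.

Fact WmulwV : right_inverse (elt [::]) Winv Wmul.
Proof.
move=> x; rewrite -[X in Wmul X _]elt_repr Wmul_elt.
by apply/eltP; rewrite -{1}(revK (repr x)); apply: wcong_revl.
Qed.

HB.instance Definition _ :=
  isGroup.Build W WmulA Wmul1w Wmulw1 WmulVw WmulwV.

Local Open Scope group_scope.

Definition s (i : 'Z_3) : W := elt [:: i].

Definition wprod (u : word) : W := \prod_(i <- u) s i.

Definition reduced_word (w : W) (u : word) : Prop :=
  wprod u = w /\ forall v : word, wprod v = w -> size u <= size v.

(* Only the alcoves c 0, ..., c (size u) are constrained. *)
Definition gallery (u : word) (c : nat -> W) : Prop :=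
  c 0 = 1 /\
  forall t, t < size u -> c t.+1 = c t \/ c t.+1 = c t * s (nth 0%R u t).

(* The set of end alcoves is the same for all reduced words of w. *)
Definition Sh (w : W) : set W :=
  [set x | exists u c,
     [/\ reduced_word w u, gallery u c & c (size u) = x]]%classic.

Definition gamma (i : 'Z_3) (k : nat) : W := \prod_(j < k) s (i + j%:R)%R.

Definition delta (i : 'Z_3) (k : nat) : W := \prod_(j < k) s (i - j%:R)%R.

Definition a (n m : nat) : W := gamma 0%R n * delta (n.+1%:R)%R m.

(* fset_set sends an infinite set to the empty one, so a positive value of
   shadow_size also says that the shadow is finite. *)
Definition shadow_size (n m : nat) : nat := #|` fset_set (Sh (a n m))|%fset.

(* Main.v *)
Require Import Defs.
From mathcomp Require Import all_boot all_order all_algebra.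
From mathcomp Require Import finmap boolp classical_sets cardinality.
From mathcomp Require Import zify lra.

(* W acts on the integers as the affine permutations of period 3: s_i
   exchanges k and k + 1 whenever k = i mod 3, and the window
   (w 0, w 1, w 2) records an alcove. An explicit length function, which a
   descent lowers by one, yields the exchange property for words and hence
   Matsumoto's theorem: reduced words of the same affine permutation are
   braid equivalent. So the action is faithful, and the set of ends of
   folded galleries does not depend on the reduced word.

   Read in the frame (w k, w (k + 1), w (k + 2)) in which the next letter of
   gamma_0(n) delta_{n+1}(m) exchanges the first two entries, the shadow is
   always cut out by a box: all affine permutations whose three entries lie
   in three explicit intervals. One letter replaces the set by its union with
   its mirror image, which is again a box. Dropping the first entry, which is
   determined by the other two, the shadow becomes a square of pairs (y, z)
   with y <> z mod 3 from which two opposite corner triangles are removed. *)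

Set Implicit Arguments.
Unset Strict Implicit.
Unset Printing Implicit Defensive.

Import GRing.Theory Num.Theory.
Local Open Scope ring_scope.

(** * Affine permutations of period 3 and the action of words *)

Definition sigma (i : 'Z_3) (k : int) : int :=
  if ((k - (i : nat)%:Z) %% 3)%Z == 0 then k + 1
  else if ((k - (i : nat)%:Z) %% 3)%Z == 1 then k - 1 else k.

Definition act (u : word) (k : int) : int := foldr sigma k u.

Lemma int3P (k : int) :
  exists q : int, [\/ k = 3 * q, k = 3 * q + 1 | k = 3 * q + 2].
Proof.
exists (k %/ 3)%Z.
have : (k %% 3)%Z = 0 \/ (k %% 3)%Z = 1 \/ (k %% 3)%Z = 2 by lia.
by move=> [|[]]; [constructor 1|constructor 2|constructor 3]; lia.
Qed.

(** Rewrite rules that bring a shifted argument back to the form [3 * q + r] on which [sigmaE]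
    computes. *)
Lemma int3_carry (q : int) :
  (3 * q + 1 + 1 = 3 * q + 2) * (3 * q + 1 + 2 = 3 * (q + 1)) *
  (3 * q + 2 + 1 = 3 * (q + 1)) * (3 * q + 2 + 2 = 3 * (q + 1) + 1).
Proof. by do !split; lia. Qed.

Lemma sigmaE (q : int) :
  ((sigma 0 (3 * q) = 3 * q + 1) * (sigma 0 (3 * q + 1) = 3 * q) *
  (sigma 0 (3 * q + 2) = 3 * q + 2)) *
  ((sigma 1 (3 * q) = 3 * q) * (sigma 1 (3 * q + 1) = 3 * q + 2) *
  (sigma 1 (3 * q + 2) = 3 * q + 1)) *
  ((sigma 2 (3 * q) = 3 * (q - 1) + 2) * (sigma 2 (3 * q + 1) = 3 * q + 1) *
  (sigma 2 (3 * q + 2) = 3 * (q + 1))).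
Proof.
have e1 : nat_of_ord (1 : 'Z_3) = 1%N :> nat by [].
have e2 : nat_of_ord (2 : 'Z_3) = 2%N :> nat by [].
by repeat split; rewrite /sigma ?e1 ?e2 /=; (repeat case: ifP => ?); lia.
Qed.

Lemma Z3P (i : 'Z_3) : [\/ i = 0, i = 1 | i = 2].
Proof.
by case: i => [[|[|[|//]]] ?]; [constructor 1|constructor 2|constructor 3];
  exact: val_inj.
Qed.

Lemma act_cat u v k : act (u ++ v) k = act u (act v k).
Proof. by rewrite /act foldr_cat. Qed.

Lemma act_rcons u i k : act (rcons u i) k = act u (sigma i k).
Proof. by rewrite -cats1 act_cat. Qed.

Lemma act_cong u v : wcong u v -> act u =1 act v.
Proof.
elim=> {u v} [r|//|u v _ E k|u v w _ E1 _ E2 k|u u' v v' _ E1 _ E2 k].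
- rewrite !inE => /or4P[|||/or3P[]] /eqP-> k;
    by case: (int3P k) => q [->|->|->] /=; rewrite !sigmaE ?subrK ?addrK.
- by rewrite E.
- by rewrite E1 E2.
- by rewrite !act_cat E2 E1.
Qed.

(** Distinct residues and the shift make [f] a bijection; the sum is that of the identity. All
    windows are covered, not only the one at 0, since the frame will move. *)
Record affine (f : int -> int) : Prop := Affine {
  affine_shift : forall k, f (k + 3) = f k + 3;
  affine_sum : forall k, f k + f (k + 1) + f (k + 2) = 3 * k + 3;
  affine_ne : forall k, (f k != f (k + 1)%R %[mod 3])%Z /\
    (f k != f (k + 2)%R %[mod 3])%Z /\ (f (k + 1)%R != f (k + 2)%R %[mod 3])%Z
 }.

Lemma sigmaD3 i k : sigma i (k + 3) = sigma i k + 3.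
Proof.
rewrite /sigma (_ : (k + 3 - (i : nat)%:Z) = k - (i : nat)%:Z + 3); last by lia.
have -> : ((k - (i : nat)%:Z + 3) %% 3 = (k - (i : nat)%:Z) %% 3)%Z by lia.
by repeat case: ifP => _; lia.
Qed.

Lemma act_affine u : affine (act u).
Proof.
elim: u => [|i u [s3 sS sD]]; first by split=> k /=; lia.
split=> k; move: (s3 k) (sS k) (sD k) => /=; first by rewrite -sigmaD3 => ->.
all: case: (int3P (act u k)) => p; case: (int3P (act u (k+1))) => q.
all: case: (int3P (act u (k+2))) => r.
all: by case: (Z3P i) => -> [] -> [] -> [] ->; rewrite !sigmaE; lia.
Qed.

Lemma affine_shiftM f : affine f -> forall k q, f (k + 3 * q) = f k + 3 * q.
Proof.
move=> [s3 _ _]; have sN k n : f (k + 3 * n%:Z) = f k + 3 * n%:Z.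
  elim: n => [|n IHn]; first by rewrite !addr0.
  have -> : k + 3 * n.+1%:Z = k + 3 * n%:Z + 3 by lia.
  by rewrite s3 IHn; lia.
move=> k [n|n]; first exact: sN.
by have := sN (k + 3 * Negz n) n.+1; rewrite NegzE mulrN subrK; lia.
Qed.

(** The sum gives the third entry and the shift all the others, so pairs of entries suffice for
    counting. *)
Lemma affine_eq f g k : affine f -> affine g ->
  f k = g k -> f (k + 1) = g (k + 1) -> f =1 g.
Proof.
move=> Af Ag e0 e1 l.
have e2 : f (k + 2) = g (k + 2).
  by have := affine_sum Af k; have := affine_sum Ag k; lia.
have E m : f m = g m -> forall q : int, f (m + 3 * q) = g (m + 3 * q).
  by move=> fm q; rewrite !affine_shiftM // fm.
case: (int3P (l - k)) => q [] lk.
- by rewrite (_ : l = k + 3 * q); [exact: E | lia].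
- by rewrite (_ : l = k + 1 + 3 * q); [exact: E | lia].
- by rewrite (_ : l = k + 2 + 3 * q); [exact: E | lia].
Qed.

(** * Descents and length *)

(* s_i is a right descent of the element acting as f. *)
Definition descent (f : int -> int) (i : 'Z_3) : bool :=
  f ((i : nat)%:Z + 1) < f (i : nat)%:Z.

(* Shi's formula: the number of hyperplanes between f and the identity. *)
Definition len (f : int -> int) : nat :=
  `|((f 1 - f 0)%R %/ 3)%Z|%N + `|((f 2 - f 1)%R %/ 3)%Z|%N
  + `|((f 2 - f 0)%R %/ 3)%Z|%N.

Lemma descentE f : affine f ->
  ((descent f 0 = (f 1 < f 0)) * (descent f 1 = (f 2 < f 1)) *
  (descent f 2 = (f 0 + 3 < f 2))).
Proof. by move=> Af; rewrite -(affine_shift Af). Qed.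

Definition swap (f : int -> int) (i : 'Z_3) (k : int) : int := f (sigma i k).

Lemma swapE f : affine f ->
  ((swap f 0 0 = f 1) * (swap f 0 1 = f 0) * (swap f 0 2 = f 2) *
   ((swap f 1 0 = f 0) * (swap f 1 1 = f 2) * (swap f 1 2 = f 1)) *
   ((swap f 2 0 = f 2 - 3) * (swap f 2 1 = f 1) * (swap f 2 2 = f 0 + 3))).
Proof.
move=> Af; rewrite /swap -(affine_shift Af).
have := sigmaE 0; rewrite mulr0 !add0r => sE.
have e : f (3 * -1 + 2) = f 2 - 3.
  by rewrite -[f 2 in RHS]/(f (3 * -1 + 2 + 3)) (affine_shift Af) addrK.
by rewrite !sE mulr1 e.
Qed.

Lemma swapK i f : swap (swap f i) i =1 f.
Proof.
move=> k; rewrite /swap; congr f; case: (int3P k) => q.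
by case: (Z3P i) => -> [] ->; rewrite !sigmaE; lia.
Qed.

Lemma affine_swap i f : affine f -> affine (swap f i).
Proof.
move=> Af; have E (q : int) :
    (f (3 * q) = f 0 + 3 * q) * (f (3 * q + 1) = f 1 + 3 * q) *
    (f (3 * q + 2) = f 2 + 3 * q).
  by rewrite -!(affine_shiftM Af) add0r ![_ + 3 * q]addrC.
have := affine_sum Af 0; have := affine_ne Af 0; rewrite /swap !add0r => N S.
split=> k; first by rewrite sigmaD3 (affine_shift Af).
all: case: (int3P k) => q; case: (Z3P i) => -> [] ->.
all: by rewrite ?int3_carry !sigmaE !E; lia.
Qed.

(** In [len_swap] a window difference x turns into -x, -x + 3 or -x + 6. The middle form keeps its
    term of [len]; the other two change it by one. *)
Lemma absz_div3 (x : int) : (x %% 3)%Z != 0 ->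
  [/\ `|((- x)%R %/ 3)%Z|%N =
       (if (x < 0)%R then `|(x %/ 3)%Z|.-1 else `|(x %/ 3)%Z|.+1)%N,
      `|((- x + 3)%R %/ 3)%Z|%N = `|(x %/ 3)%Z|%N,
      `|((- x + 6)%R %/ 3)%Z|%N =
       (if (3 < x)%R then `|(x %/ 3)%Z|.-1 else `|(x %/ 3)%Z|.+1)%N,
      x < 0 -> (0 < `|(x %/ 3)%Z|)%N & 3 < x -> (0 < `|(x %/ 3)%Z|)%N].
Proof. by move=> x3; split; try case: ifP; lia. Qed.

(** The swaps 0 and 1 negate one window difference and exchange the other two; swap 2 reflects all
    three, but only [f 2 - f 0] changes its term. *)
Lemma len_swap f i : affine f ->
  len (swap f i) = (if descent f i then (len f).-1 else (len f).+1)
  /\ (descent f i -> 0 < len f)%N.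
Proof.
move=> Af; have [] := affine_ne Af 0; rewrite !add0r /len => N1 [N2 N3].
(* Only the summand [p] changes, and the total changes in the same way. *)
have aux (b : bool) (p q r t t' : nat) : (b -> 0 < p)%N ->
    (t' = (if b then p.-1 else p.+1) + q + r -> t = p + q + r ->
     t' = (if b then t.-1 else t.+1) /\ (b -> 0 < t))%N.
  by case: b => [/(_ isT)|_]; lia.
have NA : ((f 1 - f 0)%R %% 3)%Z != 0 by lia.
have NB : ((f 2 - f 1)%R %% 3)%Z != 0 by lia.
have NC : ((f 2 - f 0)%R %% 3)%Z != 0 by lia.
have EB : f 1 - (f 2 - 3) = f 1 - f 2 + 3 by lia.
have EA : f 0 + 3 - f 1 = f 0 - f 1 + 3 by lia.
have EC : f 0 + 3 - (f 2 - 3) = f 0 - f 2 + 6 by lia.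
have [A1 A2 _ A4 _] := absz_div3 NA; have [B1 B2 _ B4 _] := absz_div3 NB.
have [_ _ C3 _ C5] := absz_div3 NC.
move: A1 A2 A4 B1 B2 B4 C3 C5; rewrite !subr_lt0 !ltrBrDl !opprB.
move=> A1 A2 A4 B1 B2 B4 C3 C5.
case: (Z3P i) => ->; rewrite !(swapE Af) !(descentE Af).
- by apply: (aux _ _ _ _ _ _ A4) => //; rewrite A1 addnAC.
- apply: (aux _ _ _ _ _ _ B4); first by rewrite B1 -addnA addnC.
  by rewrite -addnA addnCA addnA.
rewrite EA EB EC A2 B2 C3; apply: (aux _ _ _ _ _ _ C5).
  by rewrite addnC addnCA addnC.
by rewrite addnC addnA.
Qed.

Lemma descent_swap f i : affine f -> descent (swap f i) i = ~~ descent f i.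
Proof.
move=> Af; have As := affine_swap i Af; have := affine_ne Af 0.
rewrite !add0r.
case: (Z3P i) As => -> As; rewrite (descentE As) (descentE Af) !(swapE Af); lia.
Qed.

(** Here [swap f j] descends at both [i] and [j], so the three entries that s_i and s_j permute are
    decreasing, and either letter can be removed first. *)
Lemma descent_braid f i j : affine f -> i != j -> ~~ descent f j ->
  descent (swap f j) i -> descent f i && descent (swap f i) j.
Proof.
move=> Af; have := affine_swap i Af; have := affine_swap j Af.
have := affine_ne Af 0; rewrite !add0r.
case: (Z3P i) => ->; case: (Z3P j) => -> // N A1 A2 _.
all: rewrite !(descentE Af, descentE A1, descentE A2) !(swapE Af); lia.
Qed.

Lemma act_rcons_swap u i : act (rcons u i) =1 swap (act u) i.
Proof. exact: act_rcons. Qed.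

Lemma eq_descent f g : f =1 g -> descent f =1 descent g.
Proof. by move=> e i; rewrite /descent !e. Qed.

Lemma eq_len f g : f =1 g -> len f = len g.
Proof. by move=> e; rewrite /len !e. Qed.

Definition reduced u := len (act u) == size u.

Lemma len_act u : (len (act u) <= size u)%N.
Proof.
elim/last_ind: u => [|u i IHu]; first by rewrite /len.
rewrite size_rcons (eq_len (act_rcons_swap u i)).
by have [-> _] := len_swap i (act_affine u); case: ifP; lia.
Qed.

Lemma reduced_rcons u i :
  reduced (rcons u i) = reduced u && ~~ descent (act u) i.
Proof.
rewrite /reduced size_rcons (eq_len (act_rcons_swap u i)).
have [-> D] := len_swap i (act_affine u); have := len_act u.
by case: ifP D => [_ /(_ isT)|]; lia.
Qed.

Lemma descent_rcons u i : descent (act (rcons u i)) i = ~~ descent (act u) i.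
Proof.
rewrite (eq_descent (act_rcons_swap u i)) descent_swap //; exact: act_affine.
Qed.

(** * Folding along words, the exchange property and Matsumoto's theorem *)

Local Open Scope group_scope.

(* A \cup A s_i, as s_i is an involution. *)
Definition widen (A : W -> Prop) (i : 'Z_3) (x : W) : Prop :=
  A x \/ A (x * s i).

(** By [foldP], the ends of the galleries folded along [u], whether [u] is reduced or not. *)
Definition fold (u : word) : W -> Prop := foldl widen (fun x => x = 1) u.

Lemma fold_rcons u i : fold (rcons u i) = widen (fold u) i.
Proof. by rewrite /fold foldl_rcons. Qed.

Lemma elt_nil : elt [::] = 1.
Proof. by []. Qed.

Lemma elt_cons i u : elt (i :: u) = s i * elt u.
Proof. by rewrite -[i :: u]cat1s -Wmul_elt. Qed.

Lemma elt_rcons u i : elt (rcons u i) = elt u * s i.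
Proof. by rewrite -cats1 -Wmul_elt. Qed.

Lemma wprodE u : wprod u = elt u.
Proof.
elim: u => [|i u IHu]; first by rewrite /wprod big_nil.
by rewrite /wprod big_cons elt_cons -IHu.
Qed.

Lemma mulss i : s i * s i = 1.
Proof. by rewrite /s -elt_cons; apply/eltP/wcong_sq. Qed.

Lemma mulKs i x : x * s i * s i = x.
Proof. by rewrite -mulgA mulss mulg1. Qed.

Lemma mul_braid i j : i != j -> s i * s j * s i = s j * s i * s j.
Proof.
move=> Dij; have {Dij}: wcong (flatten (nseq 3 [:: i; j])) [::] \/
    wcong (flatten (nseq 3 [:: j; i])) [::].
  by case: (Z3P i) (Z3P j) Dij => -> [] -> // _;
   first [by left; apply: wcong_rel | by right; apply: wcong_rel].
(* Each braid relator is listed for one order of its two letters; the other order follows by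
   symmetry. *)
wlog H : i j / wcong (flatten (nseq 3 [:: i; j])) [::].
  by move=> IH [] H; [|symmetry]; apply: IH => //; left.
move=> _; move/eltP: H; rewrite /= !elt_cons elt_nil mulg1 !mulgA => H.
by rewrite -[RHS]mul1g -H !mulgA !mulKs.
Qed.

Lemma widen_ext A B i : (forall x, A x <-> B x) ->
  forall x, widen A i x <-> widen B i x.
Proof. by move=> e x; rewrite /widen !e. Qed.

(** Both sides are the union of the translates of [A] by all elements of the subgroup generated by
    s_i and s_j. *)
Lemma widen_braid A i j x : i != j ->
  widen (widen (widen A i) j) i x <-> widen (widen (widen A j) i) j x.
Proof.
by move=> /mul_braid; rewrite /widen !mulKs -!mulgA => ->; tauto.
Qed.

(** Stands in for braid equivalence and keeps just its consequences for length, element and folded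
    set. *)
Definition similar u v :=
  [/\ size u = size v, elt u = elt v & forall x, fold u x <-> fold v x].

Lemma similar_trans u v w : similar u v -> similar v w -> similar u w.
Proof.
move=> [e1 e2 uv] [e3 e4 vw]; split; rewrite ?e1 ?e2 //.
by move=> x; rewrite uv vw.
Qed.

Lemma similar_sym u v : similar u v -> similar v u.
Proof. by move=> [e1 e2 uv]; split=> // x; rewrite uv. Qed.

Lemma similar_rcons u v i : similar u v -> similar (rcons u i) (rcons v i).
Proof.
move=> [e1 e2 e3]; split; first by rewrite !size_rcons e1.
  by rewrite !elt_rcons e2.
by move=> x; rewrite !fold_rcons; apply: widen_ext.
Qed.

Lemma similar_braid u i j : i != j ->
  similar (rcons (rcons (rcons u i) j) i) (rcons (rcons (rcons u j) i) j).
Proof.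
move=> Dij; split; first by rewrite !size_rcons.
  by rewrite !elt_rcons -!mulgA !(mulgA (s _)) mul_braid.
by move=> x; rewrite !fold_rcons; apply: widen_braid.
Qed.

Lemma elt_act u v : elt u = elt v -> act u =1 act v.
Proof. by move/eltP/act_cong. Qed.

Lemma similar_reduced u v : similar u v -> reduced u -> reduced v.
Proof.
by case=> e /elt_act/eq_len; rewrite /reduced e => -> _.
Qed.

(** If the last letter j differs from i, [descent_braid] and two uses of the induction hypothesis
    make the word similar to w j i j, and a braid move gives w i j i. *)
Lemma exchange u i : reduced u -> descent (act u) i ->
  exists t, similar u (rcons t i).
Proof.
have [n] := ubnP (size u); elim: n u i => // n IHn u i.
case/lastP: u => [|u j]; first by case: (Z3P i) => ->.
rewrite size_rcons ltnS => ltun ru dij.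
have [<-|Dij] := eqVneq i j; first by exists u.
move: ru; rewrite reduced_rcons => /andP[ru ndj].
have Au := act_affine u.
move: dij; rewrite (eq_descent (act_rcons_swap u j)) => dij.
have /andP[di dji] := descent_braid Au Dij ndj dij.
have [t sut] := IHn u i ltun ru di.
have ast : act t =1 swap (act u) i.
  case: sut => _ /elt_act e _ k; rewrite /swap e act_rcons_swap /swap.
  exact/esym/(swapK i (act t)).
have rt : reduced t.
  by have := similar_reduced sut ru; rewrite reduced_rcons => /andP[].
have ltt : (size t < n)%N.
  by case: sut => e _ _; apply: leq_ltn_trans ltun; rewrite e size_rcons.
have [w stw] := IHn t j ltt rt ltac:(by rewrite (eq_descent ast)).
exists (rcons (rcons w i) j).
apply: similar_trans (similar_rcons _ sut) _.
apply: similar_trans (similar_rcons _ (similar_rcons _ stw)) _.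
by apply: similar_braid; rewrite eq_sym.
Qed.

(* By induction on the length: both words can be changed to end in the same
   descent i, and then i is dropped. *)
Lemma matsumoto u v : reduced u -> reduced v -> act u =1 act v -> similar u v.
Proof.
elim/last_ind: u v => [|u i IHu] v ru rv e.
  move: rv; rewrite /reduced -(eq_len e) (eqP ru) /= eq_sym => /nilP->.
  by split.
have di : descent (act v) i.
  by move: ru; rewrite -(eq_descent e) descent_rcons reduced_rcons => /andP[].
have [t svt] := exchange rv di.
have := similar_reduced svt rv; rewrite reduced_rcons => /andP[rt _].
move: ru; rewrite reduced_rcons => /andP[ru _].
apply: similar_trans (similar_sym svt); apply/similar_rcons/IHu => // k.
have := e (sigma i k); case: svt => _ /elt_act -> _.
rewrite !act_rcons_swap; have := swapK i (act u) k.
by have := swapK i (act t) k; rewrite /swap => -> ->.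
Qed.

(** Letters are appended one by one; at a descent, [exchange] brings the same letter to the end,
    where the two cancel. *)
Lemma reduction u : exists2 v, elt u = elt v & reduced v.
Proof.
elim/last_ind: u => [|u i [v e rv]]; first by exists [::].
have [di|di] := boolP (descent (act v) i); last first.
  by exists (rcons v i); rewrite ?elt_rcons ?e // reduced_rcons rv.
have [t svt] := exchange rv di; exists t.
  by case: svt => _ e' _; rewrite elt_rcons e e' elt_rcons mulKs.
by have := similar_reduced svt rv; rewrite reduced_rcons => /andP[].
Qed.

Lemma act_inj u v : act u =1 act v -> elt u = elt v.
Proof.
have [u' eu ru] := reduction u; have [v' ev rv] := reduction v => e.
rewrite eu ev; case: (@matsumoto u' v') => // k.
by rewrite -(elt_act eu) -(elt_act ev) e.
Qed.

(** * Shadows as folded sets of reduced words *)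

Lemma reduced_wordP w u : reduced_word w u <-> elt u = w /\ reduced u.
Proof.
rewrite /reduced_word wprodE; split=> -[<- H]; split=> //.
  (* Minimality is tested against a word whose size is [len]. *)
  have [v e rv] := reduction u; have := H v; rewrite wprodE e => /(_ erefl).
  move: rv; rewrite /reduced -(eq_len (elt_act e)) => /eqP <-.
  by have := len_act u; lia.
by move=> v; rewrite wprodE => /elt_act/eq_len e; rewrite -(eqP H) -e len_act.
Qed.

Lemma foldP u x : fold u x <-> exists2 c, gallery u c & c (size u) = x.
Proof.
elim/last_ind: u x => [|u i IHu] x.
  split=> [->|[c [-> _] <-]//]; by exists (fun=> 1); split.
rewrite fold_rcons size_rcons; split.
  have ext c y : gallery u c -> (y = c (size u) \/ y = c (size u) * s i) ->
    exists2 c, gallery (rcons u i) c & c (size u).+1 = y.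
    move=> [c0 cS] H; exists (fun t => if (t <= size u)%N then c t else y).
      split=> // t; rewrite size_rcons ltnS nth_rcons.
      by case: ltngtP => // [lt _|-> _]; [exact: cS|].
    by rewrite /= ltnn.
  case=> /IHu [c gc e]; apply: (ext c) => //; rewrite e; first by left.
  by right; rewrite mulKs.
move=> [c [c0 cS] <-]; have := cS (size u).
rewrite size_rcons nth_rcons ltnn eqxx => /(_ (ltnSn _)) H.
have gu : fold u (c (size u)).
  apply/IHu; exists c => //; split=> // t lt.
  by have := cS t; rewrite size_rcons nth_rcons lt => /(_ (ltnW lt)).
by case: H => ->; [left | right; rewrite mulKs].
Qed.

Lemma Sh_fold u : reduced u -> forall x, Sh (elt u) x <-> fold u x.
Proof.
move=> ru x; split=> [[v [c [/reduced_wordP[e rv] gc cx]]]|].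
  case: (@matsumoto u v) => //; first by move=> k; rewrite (elt_act e).
  by move=> _ _ ->; apply/foldP; exists c.
by move/foldP=> [c gc cx]; exists u, c; split=> //; apply/reduced_wordP.
Qed.

(** * The windows of the elements of the shadow *)

Local Open Scope ring_scope.

(** Indexing the generators by integers lets the window start anywhere: the letter of [k] exchanges
    the first two entries of the window at [k]. *)
Definition letter (k : int) : 'Z_3 := k%:~R.

Lemma letterE q : (letter (3 * q) = 0) * (letter (3 * q + 1) = 1) *
  (letter (3 * q + 2) = 2).
Proof.
have e3 : letter (3 * q) = 0.
  by rewrite /letter intrM (_ : 3%:~R = 0) ?mul0r //; apply: val_inj.
by rewrite e3 /letter !intrD -/(letter (3 * q)) e3 !add0r.
Qed.

Lemma sigma_letter k : (sigma (letter k) k = k + 1) *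
  (sigma (letter k) (k + 1) = k) * (sigma (letter k) (k + 2) = k + 2).
Proof.
case: (int3P k) => q [] ->; rewrite letterE ?int3_carry !sigmaE.
all: by do !split; lia.
Qed.

Lemma descent_letter f k : affine f -> descent f (letter k) = (f (k + 1) < f k).
Proof.
move=> Af; have E m (q : int) : f (3 * q + m) = f m + 3 * q.
  by rewrite addrC affine_shiftM.
have E0 (q : int) : f (3 * q) = f 0 + 3 * q by rewrite -E addr0.
have S3 : f (2 + 1) = f 0 + 3 := affine_shift Af 0.
have S2 : f (1 + 1) = f 2 by [].
case: (int3P k) => q [] ->; rewrite letterE descentE // -?addrA.
all: rewrite !E ?E0 ?S2 ?S3; lia.
Qed.

(* The entries at k, k + 1, k + 2 of the elements of the shadow. *)
Definition values (u : word) (k a b c : int) : Prop := exists v : word,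
  [/\ fold u (elt v), act v k = a, act v (k + 1) = b & act v (k + 2) = c].

Lemma values_rcons u k a b c : values (rcons u (letter k)) k a b c <->
  values u k a b c \/ values u k b a c.
Proof.
rewrite /values; split=> [[v []]|].
  rewrite fold_rcons => -[] Fv a1 b1 c1; [left|right].
    by exists v.
  exists (rcons v (letter k)).
  by rewrite elt_rcons !act_rcons !sigma_letter; split.
rewrite fold_rcons; case=> -[v [Fv a1 b1 c1]].
  by exists v; split => //; left.
exists (rcons v (letter k)).
by rewrite elt_rcons !act_rcons !sigma_letter; split=> //; right; rewrite mulKs.
Qed.

(** The window slides by one place: the entry at [k + 3] is the entry at [k] plus 3. *)
Lemma values_next u k a b c : values u (k + 1) a b c <-> values u k (c - 3) a b.
Proof.
split=> -[v [Fv a1 b1 c1]]; exists v; have S3 := affine_shift (act_affine v) k.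
  have e : k + 1 + 1 = k + 2 by lia.
  have e' : k + 1 + 2 = k + 3 by lia.
  by rewrite -a1 -b1 -c1 e e' S3; split=> //; lia.
have e : k + 1 + 1 = k + 2 by lia.
have e' : k + 1 + 2 = k + 3 by lia.
by rewrite e e' S3; split=> //; lia.
Qed.

Lemma values_prev u k a b c : values u (k - 1) a b c <-> values u k b c (a + 3).
Proof.
have := values_next u (k - 1) b c (a + 3); rewrite subrK addrK; tauto.
Qed.

(** What [affine] demands of the window at [k]. *)
Definition triple (k a b c : int) : Prop :=
  a + b + c = 3 * k + 3 /\
  (a != b %[mod 3])%Z /\ (a != c %[mod 3])%Z /\ (b != c %[mod 3])%Z.

Definition gword (n : nat) : word := mkseq (fun j => letter j) n.

Definition aword (n m : nat) : word :=
  gword n ++ mkseq (fun j => letter (n.+1%:Z - j%:Z)) m.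

Lemma awordS n m : aword n m.+1 = rcons (aword n m) (letter (n.+1%:Z - m%:Z)).
Proof. by rewrite /aword mkseqS rcons_cat. Qed.

Lemma a_elt n m : a n m = elt (aword n m).
Proof.
rewrite -wprodE /wprod big_cat /a /gamma /delta /=.
have big_mkseq (f : nat -> 'Z_3) k :
    (\prod_(i <- mkseq f k) s i = \prod_(j < k) s (f j))%g.
  by rewrite big_map -[k in iota 0 k]subn0 -/(index_iota 0 k) big_mkord.
rewrite !big_mkseq; congr (_ * _)%g; apply: eq_bigr => j _.
  by rewrite add0r.
by rewrite /letter intrB.
Qed.

Lemma values_gword0 a b c :
  values (gword 0) 0 a b c <-> a = 0 /\ b = 1 /\ c = 2.
Proof.
split=> [[v [Fv <- <- <-]]|[-> [-> ->]]]; last by exists [::].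
by have E := @elt_act v [::] Fv; rewrite !E.
Qed.

Lemma values_gwordS n a b c : values (gword n.+1) n.+1 a b c <->
  values (gword n) n (c - 3) a b \/ values (gword n) n a (c - 3) b.
Proof.
have -> : n.+1%:Z = n%:Z + 1 by lia.
by rewrite values_next /gword mkseqS values_rcons.
Qed.

(** The two exchanged entries may range over the union of their intervals: the fixed sum and the
    distinct residues rule out the pairs that lie in neither box. For n = 1 the entry b is still 2,
    so the induction starts at n = 2. *)
Lemma values_gword n a b c : (2 <= n)%N -> values (gword n) n a b c <->
  triple n a b c /\ 0 <= a <= ((3 * n%:Z - 1)%R %/ 2)%Z /\
  3 <= b <= ((3 * n%:Z + 2)%R %/ 2)%Z /\ 3 <= c <= ((3 * n%:Z + 5)%R %/ 2)%Z.
Proof.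
case: n => [|[|n]] // _; elim: n a b c => [|n IHn] a b c.
  rewrite !values_gwordS !values_gword0 /triple.
  rewrite (_ : (_ %/ 2)%Z = 2) // (_ : (_ %/ 2)%Z = 4) //.
  rewrite (_ : (_ %/ 2)%Z = 5) //.
  split; lia.
rewrite values_gwordS !IHn /triple.
have -> : ((3 * n.+3%:Z - 1)%R %/ 2)%Z = ((3 * n.+2%:Z + 2)%R %/ 2)%Z by lia.
have -> : ((3 * n.+3%:Z + 2)%R %/ 2)%Z =
    ((3 * n.+2%:Z - 1)%R %/ 2)%Z + 3 by lia.
have -> : ((3 * n.+3%:Z + 5)%R %/ 2)%Z =
    ((3 * n.+2%:Z + 2)%R %/ 2)%Z + 3 by lia.
have -> : ((3 * n.+2%:Z + 5)%R %/ 2)%Z =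
    ((3 * n.+2%:Z - 1)%R %/ 2)%Z + 3 by lia.
(* With these two facts recorded, the floors can be replaced by variables. *)
have : ((3 * n.+2%:Z - 1)%R %/ 2)%Z + ((3 * n.+2%:Z + 2)%R %/ 2)%Z =
    3 * n.+2%:Z by lia.
have : 2 * ((3 * n.+2%:Z - 1)%R %/ 2)%Z <= 3 * n.+2%:Z - 1 <=
    2 * ((3 * n.+2%:Z - 1)%R %/ 2)%Z + 1 by lia.
move: (_ %/ 2)%Z (_ %/ 2)%Z => H B.
have -> : n.+3%:Z = n.+2%:Z + 1 by lia.
split; lia.
Qed.

Lemma aword0 n : aword n 0 = gword n.
Proof. exact: cats0. Qed.

Lemma values_awordS n m a b c :
  values (aword n m.+1) (n.+1%:Z - m.+1%:Z) a b c <->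
  values (aword n m) (n.+1%:Z - m%:Z) b c (a + 3) \/
  values (aword n m) (n.+1%:Z - m%:Z) c b (a + 3).
Proof.
have -> : n.+1%:Z - m.+1%:Z = n.+1%:Z - m%:Z - 1 by lia.
by rewrite values_prev awordS values_rcons.
Qed.

(** The frame now moves back: the upper bounds stay and the lower ones decrease. At m = 0 the first
    entry still reaches (3 n + 2) / 2, so the induction starts at m = 1. *)
Lemma values_aword n m a b c : (2 <= n)%N -> (1 <= m)%N ->
  values (aword n m) (n.+1%:Z - m%:Z) a b c <->
  triple (n.+1%:Z - m%:Z) a b c /\
  3 - 3 * ((m%:Z + 1)%R %/ 2)%Z <= a <= ((3 * n%:Z - 1)%R %/ 2)%Z /\
  3 - 3 * (m%:Z %/ 2)%Z <= b <= ((3 * n%:Z + 5)%R %/ 2)%Z /\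
  3 - 3 * (m%:Z %/ 2)%Z <= c <= ((3 * n%:Z + 5)%R %/ 2)%Z.
Proof.
move=> n2; have eH : ((3 * n%:Z + 5)%R %/ 2)%Z =
  ((3 * n%:Z - 1)%R %/ 2)%Z + 3 by lia.
have eB : ((3 * n%:Z - 1)%R %/ 2)%Z + ((3 * n%:Z + 2)%R %/ 2)%Z = 3 * n%:Z.
  by lia.
have leH : 2 * ((3 * n%:Z - 1)%R %/ 2)%Z <= 3 * n%:Z - 1 <=
  2 * ((3 * n%:Z - 1)%R %/ 2)%Z + 1 by lia.
case: m => // m _; elim: m a b c => [|m IHm] a b c.
  rewrite values_awordS aword0 subr0 (_ : n.+1%:Z = n%:Z + 1); last by lia.
  rewrite !values_next !values_gword // /triple eH.
  rewrite (_ : ((1 + 1)%R %/ 2)%Z = 1) // (_ : (1 %/ 2)%Z = 0) //.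
  move: leH eB => {eH}; move: (_ %/ 2)%Z (_ %/ 2)%Z => H B.
  split; lia.
rewrite values_awordS !IHm /triple eH.
have -> : ((m.+2%:Z + 1)%R %/ 2)%Z = (m.+1%:Z %/ 2)%Z + 1 by lia.
have -> : (m.+2%:Z %/ 2)%Z = ((m.+1%:Z + 1)%R %/ 2)%Z by lia.
have : (m.+1%:Z %/ 2)%Z + ((m.+1%:Z + 1)%R %/ 2)%Z = m.+1%:Z by lia.
have : 2 * (m.+1%:Z %/ 2)%Z <= m.+1%:Z <= 2 * (m.+1%:Z %/ 2)%Z + 1 by lia.
move: leH {IHm eH eB}.
move: (m.+1%:Z %/ 2)%Z ((m.+1%:Z + 1)%R %/ 2)%Z (_ %/ 2)%Z => P Q H.
have -> : m.+2%:Z = m.+1%:Z + 1 by lia.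
split; lia.
Qed.

(** * The word of the alcove is reduced *)

Lemma act_gword n :
  act (gword n) n = 0 /\ act (gword n) (n%:Z + 1) = ((3 * n%:Z + 2)%R %/ 2)%Z
  /\ act (gword n) (n%:Z + 2) = ((3 * n%:Z + 5)%R %/ 2)%Z.
Proof.
elim: n => [|n IHn] //.
rewrite /gword mkseqS -/(gword n) !act_rcons.
have -> : n.+1%:Z + 1 = n%:Z + 2 by lia.
have -> : n.+1%:Z + 2 = n%:Z + 3 by lia.
have -> : n.+1%:Z = n%:Z + 1 by lia.
rewrite sigmaD3 !sigma_letter (affine_shift (act_affine _)); lia.
Qed.

(** The first two entries are tracked because comparing them shows that the next letter is an
    ascent. *)
Lemma act_aword n m : 
  act (aword n m) (n.+1%:Z - m%:Z) =
    (if odd m then 3 - 3 * ((m%:Z + 1)%R %/ 2)%Z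
     else ((3 * n%:Z + 2)%R %/ 2)%Z - 3 * (m%:Z %/ 2)%Z) /\
  act (aword n m) (n.+1%:Z - m%:Z + 1) = ((3 * n%:Z + 5)%R %/ 2)%Z.
Proof.
have Af := affine_shift (act_affine _); elim: m => [|m].
  rewrite aword0 subr0 /=; have -> : n.+1%:Z = n%:Z + 1 by lia.
  have -> : n%:Z + 1 + 1 = n%:Z + 2 by lia.
  by have := act_gword n; lia.
(* The new first entry is the old third one minus 3, which the sum determines. *)
have := affine_sum (act_affine (aword n m)) (n.+1%:Z - m%:Z).
have := Af (aword n m) (n.+1%:Z - m.+1%:Z).
rewrite awordS !act_rcons; set k := n.+1%:Z - m%:Z.
have -> : n.+1%:Z - m.+1%:Z = k - 1 by rewrite /k; lia.
have -> : k - 1 + 3 = k + 2 by lia.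
have e : sigma (letter k) (k - 1) = k - 1.
  have := sigmaD3 (letter k) (k - 1).
  by rewrite (_ : k - 1 + 3 = k + 2) ?sigma_letter; lia.
by rewrite subrK !sigma_letter e /= /k; case: (boolP (odd m)) => /=; lia.
Qed.

Lemma reduced_aword n m : reduced (aword n m).
Proof.
elim: m => [|m IHm]; last first.
  rewrite awordS reduced_rcons IHm (descent_letter _ (act_affine _)).
  by have := act_aword n m; case: (boolP (odd m)); lia.
rewrite aword0; elim: n => [|n IHn] //.
rewrite /gword mkseqS -/(gword n) reduced_rcons IHn.
rewrite (descent_letter _ (act_affine _)).
by have := act_gword n; lia.
Qed.

(** * Counting pairs with distinct residues in a truncated square *)

Local Open Scope nat_scope.

Lemma nat3P (n : nat) : exists k, n = 3 * k \/ n = 3 * k + 1 \/ n = 3 * k + 2.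
Proof. by exists (n %/ 3); lia. Qed.

Lemma sum_residue r N : r < 3 ->
  \sum_(0 <= x < N) (x %% 3 != r) = N - (N + 2 - r) %/ 3.
Proof.
move=> r3; elim: N => [|N IHN]; first by rewrite big_nil; lia.
by rewrite big_nat_recr //= IHN; lia.
Qed.

(** Each step adds a row and a column, counted by [sum_residue]; their common corner contributes
    nothing. *)
Lemma count_square M :
  \sum_(0 <= x < M) \sum_(0 <= y < M) (x %% 3 != y %% 3) = 2 * (M * M %/ 3).
Proof.
elim: M => [|M IHM]; first by rewrite big_nil.
rewrite big_nat_recr //=.
under eq_bigr do rewrite big_nat_recr //=.
rewrite big_split /= IHM sum_residue ?ltn_mod // big_nat_recr //= eqxx.
under eq_bigr do rewrite eq_sym.
rewrite sum_residue ?ltn_mod //.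
by have [k [->|[->|->]]] := nat3P M; lia.
Qed.

Lemma count_line M L : L < M ->
  \sum_(0 <= x < M) \sum_(0 <= y < M) ((x + y == L) && (x %% 3 != y %% 3)) =
  L.+1 - L.+1 %/ 3 - (L %% 3 == 0).
Proof.
move=> LM; rewrite (big_cat_nat_idem _ (n := L.+1)) //=.
rewrite [X in _ + X]big1_seq ?addn0; last first.
  by move=> x; rewrite mem_index_iota => H; rewrite big1 // => y _; lia.
(* On the line x + y = L, x = y mod 3 means x = 2 L mod 3. *)
have -> : L.+1 - L.+1 %/ 3 - (L %% 3 == 0) =
    L.+1 - (L.+1 + 2 - (2 * L) %% 3) %/ 3 by lia.
rewrite -sum_residue ?ltn_mod //; apply: eq_big_nat => x Hx.
rewrite (bigD1_seq (L - x)) ?iota_uniq ?mem_index_iota //=; last by lia.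
rewrite big1 => [|y Hy]; last first.
  by have -> : (x + y == L) = false by lia.
rewrite addn0 subnKC; last by lia.
have -> : (x != L - x %[mod 3]) = (x != 2 * L %[mod 3]) by lia.
by rewrite eqxx.
Qed.

(** The triangle is swept out by the lines of [count_line]. *)
Lemma count_triangle M L : L <= M ->
  \sum_(0 <= x < M) \sum_(0 <= y < M) ((x + y < L) && (x %% 3 != y %% 3)) =
  L * L.+1 %/ 3.
Proof.
elim: L => [|L IHL] LM.
  by rewrite big1 // => x _; rewrite big1.
have -> : L.+1 * L.+2 %/ 3 =
    L * L.+1 %/ 3 + (L.+1 - L.+1 %/ 3 - (L %% 3 == 0)).
  by have [k [->|[->|->]]] := nat3P L; lia.
rewrite -IHL; last by lia.
rewrite -(count_line LM) -big_split; apply: eq_bigr => x _ /=.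
rewrite -big_split; apply: eq_bigr => y _ /=; lia.
Qed.

(** Two opposite corner triangles are cut off the square; [L <= U] keeps them disjoint and
    [M.-1 <= U] keeps the upper one a full triangle. *)
Lemma count_hexagon M L U : L <= M -> L <= U -> M.-1 <= U ->
  let L' := 2 * M.-1 - U in
  \sum_(0 <= x < M) \sum_(0 <= y < M)
    ((L <= x + y <= U) && (x %% 3 != y %% 3))
    + L * L.+1 %/ 3 + L' * L'.+1 %/ 3 = 2 * (M * M %/ 3).
Proof.
move=> LM LU MU L'; have L'M : L' <= M by rewrite /L'; lia.
have <- : \sum_(0 <= x < M) \sum_(0 <= y < M)
    ((U < x + y) && (x %% 3 != y %% 3)) = L' * L'.+1 %/ 3.
  (* Reversing both coordinates carries the upper corner to the lower one. *)
  rewrite -(count_triangle L'M) big_nat_rev; apply: eq_big_nat => x Hx.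
  rewrite big_nat_rev; apply: eq_big_nat => y Hy; rewrite !add0n /L'.
  by congr nat_of_bool; lia.
rewrite -(count_triangle LM) -count_square -!big_split; apply/eq_bigr => x _ /=.
by rewrite -!big_split; apply/eq_bigr => y _ /=; lia.
Qed.

Definition hexagon (M L U : nat) : seq (nat * nat) :=
  [seq p <- [seq (x, y) | x <- iota 0 M, y <- iota 0 M] |
    (L <= p.1 + p.2 <= U) && (p.1 %% 3 != p.2 %% 3)].

Lemma hexagon_uniq M L U : uniq (hexagon M L U).
Proof.
by rewrite filter_uniq // allpairs_uniq ?iota_uniq // => -[x y] [x' y'].
Qed.

Lemma mem_hexagon M L U x y : ((x, y) \in hexagon M L U) =
  [&& x < M, y < M, L <= x + y <= U & x %% 3 != y %% 3].
Proof.
rewrite mem_filter /= [RHS]andbA andbC; congr (_ && _).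
apply/allpairsP/andP => [[[x' y'] /= []]|[xM yM]].
  by rewrite !mem_iota => ? ? [-> ->].
by exists (x, y); rewrite !mem_iota.
Qed.

Lemma size_hexagon M L U : L <= M -> L <= U -> M.-1 <= U ->
  let L' := 2 * M.-1 - U in
  size (hexagon M L U) + L * L.+1 %/ 3 + L' * L'.+1 %/ 3 = 2 * (M * M %/ 3).
Proof.
move=> LM LU MU L'; rewrite -(count_hexagon LM LU MU) size_filter -sum1_count.
by rewrite big_mkcond big_allpairs /= /index_iota subn0; do 2!congr (_ + _).
Qed.

(** * The shadow as a hexagon of pairs *)

Local Open Scope ring_scope.

Lemma Sh_a n m x : Sh (a n m) x <-> fold (aword n m) x.
Proof. by rewrite a_elt; apply/Sh_fold/reduced_aword. Qed.

(** Here [l] is the common lower bound of the last two entries in [values_aword], so on the shadow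
    the absolute values lose no sign. *)
Definition coordinates (n m : nat) (x : W) : nat * nat :=
  let k := n.+1%:Z - m%:Z in let l := 3 - 3 * (m%:Z %/ 2)%Z in
  (`|act (repr x) (k + 1)%R - l|%N, `|act (repr x) (k + 2)%R - l|%N).

(** The side of the square comes from the intervals of the last two entries; the bounds on the sum
    come from the upper and lower bounds on the first entry. *)
Definition shadow_hexagon (n m : nat) : seq (nat * nat) :=
  hexagon ((3 * n + 1) %/ 2 + 3 * (m %/ 2))
    (3 * n - 3 * odd m - (3 * n - 1) %/ 2) (3 * n - 3 + 3 * (m %/ 2)).

Lemma values_act u v k : fold u (elt v) ->
  values u k (act v k) (act v (k + 1)) (act v (k + 2)).
Proof. by exists v. Qed.

(** Modulo 3, -y - z = y amounts to z = y, so the three conditions coincide. *)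
Lemma residues_ne (K L : int) (y z : nat) :
  (3 * K - y%:Z - z%:Z != 3 * L + y%:Z %[mod 3])%Z /\
  (3 * K - y%:Z - z%:Z != 3 * L + z%:Z %[mod 3])%Z /\
  (3 * L + y%:Z != 3 * L + z%:Z %[mod 3])%Z <-> (y != z %[mod 3])%N.
Proof. lia. Qed.

Lemma values_hexagon n m (y z : nat) : (2 <= n)%N -> (2 <= m)%N ->
  let k := n.+1%:Z - m%:Z in let l := 3 - 3 * (m%:Z %/ 2)%Z in
  values (aword n m) k (3 * k + 3 - (l + y%:Z) - (l + z%:Z)) (l + y%:Z)
    (l + z%:Z) <-> (y, z) \in shadow_hexagon n m.
Proof.
move=> n2 m2 k l; rewrite values_aword //; last exact: ltnW.
rewrite /triple mem_hexagon -/k -/l.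
(* The arguments K and L satisfy 3 L = l and 3 K = 3 k + 3 - 2 l. *)
have := residues_ne (k + 1 - 2 * (1 - (m %/ 2)%N%:Z)) (1 - (m %/ 2)%N%:Z) y z.
have eP : (m%:Z %/ 2)%Z = (m %/ 2)%N%:Z by lia.
have eQ : ((m%:Z + 1)%R %/ 2)%Z = (m %/ 2)%N%:Z + (odd m)%:Z by lia.
have eH : ((3 * n%:Z - 1)%R %/ 2)%Z = ((3 * n - 1) %/ 2)%N%:Z by lia.
have eH5 : ((3 * n%:Z + 5)%R %/ 2)%Z = ((3 * n - 1) %/ 2)%N%:Z + 3 by lia.
have eH1 : ((3 * n + 1) %/ 2 = (3 * n - 1) %/ 2 + 1)%N by lia.
have em : m%:Z = 2 * (m %/ 2)%N%:Z + (odd m)%:Z by lia.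
have e1 : (3 * n - 2 <= 2 * ((3 * n - 1) %/ 2) < 3 * n)%N by lia.
have -> : 3 * (k + 1 - 2 * (1 - (m %/ 2)%N%:Z)) - y%:Z - z%:Z =
  3 * k + 3 - (l + y%:Z) - (l + z%:Z) by rewrite /k /l eP; lia.
have -> : 3 * (1 - (m %/ 2)%N%:Z) = l by rewrite /l eP; lia.
rewrite eQ eH eH5 eH1 /k em /l eP.
move: em {eQ eH eH5 eH1 k l eP}.
move: (m %/ 2)%N ((3 * n - 1) %/ 2)%N e1 => P H e1.
move: (odd m) => o _ ->; move: (y != z %[mod 3]) => r.
by case: o; case: r => /=; lia.
Qed.

Lemma coordinates_image n m : (2 <= n)%N -> (2 <= m)%N ->
  (coordinates n m @` Sh (a n m) = [set` shadow_hexagon n m])%classic.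
Proof.
move=> n2 m2; pose l := 3 - 3 * (m%:Z %/ 2)%Z; pose k := n.+1%:Z - m%:Z.
apply/seteqP; split=> [_ [x /Sh_a Sx <-]|[y z]] /=.
  rewrite -(elt_repr x) in Sx; have V := values_act k Sx.
  apply/values_hexagon => //; rewrite /coordinates -/k -/l.
  have [_ [_ [/andP[lb _] /andP[lc _]]]] :=
    (values_aword _ _ _ n2 (ltnW m2)).1 V.
  have S := affine_sum (act_affine (repr x)) k.
  rewrite !gez0_abs ?subr_ge0 // ![l + _]addrC !subrK.
  have <- : act (repr x) k =
      3 * k + 3 - act (repr x) (k + 1) - act (repr x) (k + 2).
    by rewrite -S; lia.
  exact: V.
move/values_hexagon => /(_ n2 m2) [v [Fv _ vb vc]].
exists (elt v); first exact/Sh_a.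
have e := elt_act (elt_repr (elt v)).
by rewrite /coordinates !e vb vc -/l ![l + _]addrC !addrK.
Qed.

Lemma absz_subIl (l b c : int) :
  l <= b -> l <= c -> `|b - l|%N = `|c - l|%N -> b = c.
Proof. lia. Qed.

Lemma coordinates_inj n m : (2 <= n)%N -> (2 <= m)%N ->
  {in Sh (a n m) &, injective (coordinates n m)}.
Proof.
move=> n2 m2 x y; rewrite !inE => /Sh_a Sx /Sh_a Sy.
rewrite -(elt_repr x) in Sx; rewrite -(elt_repr y) in Sy.
have := values_act (n.+1%:Z - m%:Z) Sx; have := values_act (n.+1%:Z - m%:Z) Sy.
rewrite !values_aword; try lia; rewrite /coordinates /=.
move=> [_ [_ [/andP[b1 _] /andP[c1 _]]]].
move=> [_ [_ [/andP[b2 _] /andP[c2 _]]]] [e1 e2].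
(* The lower bounds undo the absolute values; two equal entries and faithfulness then give equal
   elements. *)
rewrite -(elt_repr x) -(elt_repr y); apply: act_inj.
apply: (@affine_eq _ _ (n.+1%:Z - m%:Z + 1)); try exact: act_affine.
  exact: absz_subIl e1.
have -> : n.+1%:Z - m%:Z + 1 + 1 = n.+1%:Z - m%:Z + 2 by lia.
exact: absz_subIl e2.
Qed.

(** * The size of the shadow and the four formulas *)

Lemma card_eq_seq (T : eqType) (t : seq T) :
  uniq t -> ([set` t] #= `I_(size t))%card.
Proof.
case: t => [|x t] Ut; first by rewrite set_nil II0 card_eq00.
have <- : (nth x (x :: t) @` `I_(size (x :: t)) = [set` x :: t])%classic.
  apply/seteqP; split=> [_ [i /= lti <-]|y /= ty]; first exact: mem_nth.
  by exists (index y (x :: t)); [rewrite -index_mem in ty | exact: nth_index].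
apply: (@inj_card_eq _ _ `I_(size (x :: t))) => i j.
rewrite !inE /= => lti ltj /eqP.
by rewrite nth_uniq // => /eqP.
Qed.

Lemma shadow_sizeE n m : (2 <= n)%N -> (2 <= m)%N ->
  shadow_size n m = size (shadow_hexagon n m).
Proof.
move=> n2 m2; apply: card_fset_set.
have := inj_card_eq (@coordinates_inj n m n2 m2); rewrite card_eq_sym.
move/card_eq_trans; apply; rewrite coordinates_image //.
exact/card_eq_seq/hexagon_uniq.
Qed.

(** The four formulas are cleared of denominators and subtractions, to be proved over the
    naturals. *)
Lemma shadow_hexagon_size n m : (2 <= n)%N -> (2 <= m)%N ->
  let S := size (shadow_hexagon n m) in
  (if odd n then
     if odd m then 4 * S + 12 * m + 6 = 12 * n * m + 3 * n ^ 2 + 3 * m ^ 2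
     else 4 * S + 6 * m + 11 = 12 * n * m + 3 * n ^ 2 + 3 * m ^ 2
   else
     if odd m then
       4 * S + 6 * n + 12 * m = 12 * n * m + 3 * n ^ 2 + 3 * m ^ 2 + 9
     else 4 * S + 6 * n + 6 * m = 12 * n * m + 3 * n ^ 2 + 3 * m ^ 2)%N.
Proof.
move=> n2 m2 S; pose M := ((3 * n + 1) %/ 2 + 3 * (m %/ 2))%N.
pose L := (3 * n - 3 * odd m - (3 * n - 1) %/ 2)%N.
pose U := (3 * n - 3 + 3 * (m %/ 2))%N.
have LM : (L <= M)%N by rewrite /L /M; lia.
have LU : (L <= U)%N by rewrite /L /U; lia.
have MU : (M.-1 <= U)%N by rewrite /M /U; lia.
have := size_hexagon LM LU MU.
rewrite -[hexagon M L U]/(shadow_hexagon n m) -/S => {LM LU MU}.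
(* Writing half of n as [p.+1] makes the truncated subtractions exact. *)
have [p [b en]] : exists p (b : bool), n = (2 * p.+1 + b)%N.
  by exists (n %/ 2).-1, (odd n); lia.
have [q [c em]] : exists q (c : bool), m = (2 * q + c)%N.
  by exists (m %/ 2)%N, (odd m); lia.
rewrite /L /U /M en em; move: S => S {L U M n2 m2 en em}.
have oE k (d : bool) : odd (2 * k + d) = d by lia.
have hE k (d : bool) : ((2 * k + d) %/ 2 = k)%N by lia.
rewrite !oE !hE.
have -> : ((3 * (2 * p.+1 + b) + 1) %/ 2 = 3 * p.+1 + 2 * b)%N by lia.
have -> : (3 * (2 * p.+1 + b) - 3 * c - (3 * (2 * p.+1 + b) - 1) %/ 2 =
  3 * (p + ~~ c) + 1 + b)%N by lia.
have -> : (2 * (3 * p.+1 + 2 * b + 3 * q).-1 -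
  (3 * (2 * p.+1 + b) - 3 + 3 * q) = 3 * q + 1 + b)%N by lia.
have -> : (3 * p.+1 + 2 * b + 3 * q = 3 * (p + q).+1 + 2 * b)%N by lia.
(* Both triangles have size 3 k + 1 + b and the square has side 3 k + 2 b for suitable k, so the
   floors become polynomials. *)
have tri (k : nat) : ((3 * k + 1 + b) * (3 * k + 1 + b).+1 %/ 3
    = 3 * (k * k) + 3 * k + b * (2 * k + 2))%N by case: b; lia.
have sq k : (2 * ((3 * k + 2 * b) * (3 * k + 2 * b) %/ 3)
    = 6 * (k * k) + b * (8 * k + 2))%N by case: b {tri}; lia.
by rewrite !tri sq; case: b {tri sq}; case: c; lia.
Qed.

Theorem corollary6p4 (n m : nat) (hn : (2 <= n)%N) (hm : (2 <= m)%N) :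
  let x : rat := n%:R in
  let y : rat := m%:R in
  (shadow_size n m)%:R =
    match odd n, odd m with
    | false, false =>
        (12 * x * y + 3 * x ^+ 2 + 3 * y ^+ 2 - 6 * x - 6 * y) / 4
    | false, true =>
        (12 * x * y + 3 * x ^+ 2 + 3 * y ^+ 2 - 6 * x - 12 * y + 9) / 4
    | true, false =>
        (12 * x * y + 3 * x ^+ 2 + 3 * y ^+ 2 - 6 * y - 11) / 4
    | true, true =>
        (12 * x * y + 3 * x ^+ 2 + 3 * y ^+ 2 - 12 * y - 6) / 4
    end :> rat.
Proof.
move=> x y; rewrite (shadow_sizeE hn hm).
case: (odd n) (odd m) (shadow_hexagon_size hn hm) => -[].
all: move=> /(congr1 (fun k => k%:R : rat)).
all: by rewrite !natrD !natrM ?natrX -/x -/y; lra.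
Qed.
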